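(* Let $V$ be a superspace and let $a,b,c$ be $\mathrm{End}(V)$-valued fields. Then $$[a_\lambda :bc:]=:[a_\lambda b]c:+p(a,b):b[a_\lambda c]:+\int_0^\lambda[[a_\lambda b]_\mu c]\,d\mu .$$
   Context: All vector spaces are over $\mathbb{C}$. $\mathrm{End}(V)$ is an associative superalgebra, also a Lie superalgebra with $[x,y]=xy-p(x,y)yx$, where $p(x,y)=(-1)^{p(x)p(y)}$. A formal distribution $a(z)=\sum_{n\in\mathbb{Z}}a_{(n)}z^{-n-1}$ has all modes of the same parity, which is its parity; it is an $\mathrm{End}(V)$-valued field if $a(z)v\in V[[z]][z^{-1}]$ for all $v\in V$. $\mathrm{Res}_z$ is the coefficient of $z^{-1}$. Put $a(z)_+=\sum_{n\le-1}a_{(n)}z^{-n-1}$ and $a(z)_-=\sum_{n\ge0}a_{(n)}z^{-n-1}$. The normal product of fields is the field $:ab:=\,:a(w)b(w):=a(w)_+b(w)+p(a,b)b(w)a(w)_-$. For $j\ge0$, $a_{(j)}b=\mathrm{Res}_z(z-w)^j[a(z),b(w)]$, and the $\lambda$-bracket is $[a_\lambda b]=\mathrm{Res}_z\,e^{\lambda(z-w)}[a(z),b(w)]=\sum_{j\ge0}\frac{\lambda^j}{j!}a_{(j)}b$, a formal power series in $\lambda$. Normal products and $\lambda$-brackets with series in $\lambda$ are taken coefficientwise in $\lambda$, and $\int_0^\lambda[[a_\lambda b]_\mu c]\,d\mu=\sum_{k\ge0}\frac{\lambda^{k+1}}{(k+1)!}[a_\lambda b]_{(k)}c$ (formal integration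 in $\mu$). *)

(* Defs.v *)
From mathcomp Require Import all_boot all_order all_algebra.
From mathcomp Require Import boolp classical_sets functions cardinality fsbigop.
From mathcomp Require Import zify.

Set Implicit Arguments.
Unset Strict Implicit.
Unset Printing Implicit Defensive.

Import Order.TTheory GRing.Theory Num.Theory.
Local Open Scope ring_scope.

(* [sspart false] and [sspart true] are the even and odd parts. *)
Record superspace (K : numFieldType) := Superspace {
  sscarrier :> lmodType K;
  sspart : bool -> {pred sscarrier};
  sspart_submod : forall i, GRing.submod_closed (sspart i);
  sspart_decomp : forall v, exists v0 v1,
    [/\ v0 \in sspart false, v1 \in sspart true & v = v0 + v1];
  sspart_direct : forall v,
    v \in sspart false -> v \in sspart true -> v = 0 }.
Arguments sspart {K} V i : rename.

(* [a n] is the mode a_(n), i.e. the coefficient of z^(-n-1). The zero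
   distribution is homogeneous of both parities, hence the explicit
   [parity]. *)
Record field_on (K : numFieldType) (V : superspace K) := FieldOn {
  modes :> int -> V -> V;
  parity : bool;
  modes_linear : forall n, linear (modes n);
  modes_parity : forall n i v,
    v \in sspart V i -> modes n v \in sspart V (i (+) parity);
  modes_trunc : forall v, exists N : int, forall n : int, N <= n -> modes n v = 0 }.

#[local] Obligation Tactic := idtac.

Section Operations.
Context {K : numFieldType} {V : superspace K}.
Implicit Types (a b c : field_on V) (x y : int -> V -> V)
  (D : int -> int -> V -> V).

Definition psign a b : K := (-1) ^+ (parity a && parity b).

Lemma sspart0 i : 0 \in sspart V i.
Proof. by case: (sspart_submod V i). Qed.

Lemma sspartL i k (u v : V) :
  u \in sspart V i -> v \in sspart V i -> k *: u + v \in sspart V i.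
Proof. by case: (sspart_submod V i) => _; apply. Qed.

Lemma sspartZ i k (u : V) : u \in sspart V i -> k *: u \in sspart V i.
Proof. by move=> ui; rewrite -[_ *: _]addr0 sspartL// sspart0. Qed.

Lemma sspartD i (u v : V) :
  u \in sspart V i -> v \in sspart V i -> u + v \in sspart V i.
Proof. by move=> ui vi; rewrite -[u]scale1r sspartL. Qed.

Lemma modesP a n k u v : a n (k *: u + v) = k *: a n u + a n v.
Proof. exact: (modes_linear a n). Qed.

Lemma modes0 a n : a n 0 = 0.
Proof. by rewrite -[X in a n X](addNr 0) -[- 0]scaleN1r modesP scaleN1r addNr. Qed.

Lemma modes_trunc_seq a (s : nat -> V) (k : nat) :
  exists N : int, forall n : int, N <= n -> forall i, (i < k)%N -> a n (s i) = 0.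
Proof.
elim: k => [|k [N HN]]; first by exists 0.
have [M HM] := modes_trunc a (s k).
exists (Num.max N M) => n; rewrite ge_max => /andP[Nn Mn] i.
by rewrite ltnS leq_eqVlt => /predU1P[->|/HN->//]; apply: HM.
Qed.

(* Distributions in z and w: [D m n] is the coefficient of
   z^(-m-1) w^(-n-1). *)
Definition comm2 a b : int -> int -> V -> V :=
  fun m n v => a m (b n v) - psign a b *: b n (a m v).

Definition mul_zw D : int -> int -> V -> V :=
  fun m n => D (m + 1) n - D m (n + 1).

Definition Res_z D : int -> V -> V := D 0.

Let good (p : bool) D :=
  [/\ forall m n, linear (D m n),
      forall m n i v, v \in sspart V i -> D m n v \in sspart V (i (+) p)
    & forall m v, exists N : int, forall n : int, N <= n -> D m n v = 0].

Let good_comm2 a b : good (parity a (+) parity b) (comm2 a b).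
Proof.
split=> [m n k u v|m n i v vi|m v].
- rewrite /comm2 !modesP scalerBr scalerDr !scalerA mulrC opprD.
  by rewrite addrACA.
- rewrite /comm2 -scaleNr addrC; apply: sspartL.
    by rewrite addbA; do 2!apply: modes_parity.
  rewrite [_ (+) parity b]addbC addbA.
  by do 2!apply: modes_parity.
- have [N1 H1] := modes_trunc b v; have [N2 H2] := modes_trunc b (a m v).
  exists (Num.max N1 N2) => n; rewrite ge_max => /andP[/H1 e1 /H2 e2].
  by rewrite /comm2 e1 e2 modes0 scaler0 subr0.
Qed.

Let good_mul_zw p D : good p D -> good p (mul_zw D).
Proof.
move=> [lD pD tD]; split=> [m n k u v|m n i v vi|m v].
- by rewrite /mul_zw !fctE !lD scalerBr opprD addrACA.
- rewrite /mul_zw !fctE -scaleN1r addrC; apply: sspartL; exact: pD.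
- have [N1 H1] := tD (m + 1) v; have [N2 H2] := tD m v.
  exists (Num.max N1 N2) => n; rewrite ge_max => /andP[h1 h2].
  by rewrite /mul_zw !fctE H1// H2 ?subr0//; lia.
Qed.

Let good_iter a b j :
  good (parity a (+) parity b) (iter j mul_zw (comm2 a b)).
Proof. by elim: j => [|j IH]; [exact: good_comm2|exact: good_mul_zw]. Qed.

Program Definition nproduct (j : nat) a b : field_on V :=
  @FieldOn K V (Res_z (iter j mul_zw (comm2 a b)))
    (parity a (+) parity b) _ _ _.
Next Obligation. by move=> j a b n; case: (good_iter a b j) => + _ _; apply. Qed.
Next Obligation. by move=> j a b n i v; case: (good_iter a b j) => _ + _; apply. Qed.
Next Obligation. by move=> j a b v; case: (good_iter a b j) => _ _; apply. Qed.

Program Definition scale_field (k : K) a : field_on V :=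
  @FieldOn K V (k *: (a : int -> V -> V)) (parity a) _ _ _.
Next Obligation.
by move=> k a n l u v; rewrite !fctE modesP scalerDr !scalerA mulrC.
Qed.
Next Obligation. by move=> k a n i v vi; apply/sspartZ/modes_parity. Qed.
Next Obligation.
move=> k a v; have [N HN] := modes_trunc a v.
by exists N => n /HN e; rewrite !fctE e scaler0.
Qed.

(* The sequence of coefficients of [a_lambda b], a power series in lambda. *)
Definition lambda_bracket a b : nat -> field_on V :=
  fun j => scale_field (j`!%:R)^-1 (nproduct j a b).

Definition dist_plus x : int -> V -> V := fun n => if n <= -1 then x n else 0.
Definition dist_minus x : int -> V -> V := fun n => if 0 <= n then x n else 0.

(* The product x(w)y(w). The sum over all integers is the finite-support sum,
   which is 0 by convention when infinitely many terms are nonzero; this does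
   not occur for the two products below (see [fin_plus] and [fin_minus]). *)
Definition dist_mul x y : int -> V -> V :=
  fun n v => \sum_(i \in [set: int]) x i (y (n - i - 1) v).

Definition normal_modes a b : int -> V -> V :=
  dist_mul (dist_plus a) b + psign a b *: dist_mul b (dist_minus a).

Let finite_int_itv (lo hi : int) : finite_set [set i | lo <= i < hi].
Proof.
apply: (@sub_finite_set _ _ [set lo + k%:Z | k in `I_(`|hi - lo|%N)]).
  by move=> i /= ?; exists (`|i - lo|%N) => /=; lia.
exact/finite_image/finite_II.
Qed.

Lemma fin_plus a b n v :
  finite_set [set i | dist_plus a i (b (n - i - 1) v) != 0].
Proof.
have [N HN] := modes_trunc b v.
apply: sub_finite_set (finite_int_itv (n - 1 - N) 0) => i /=.
rewrite /dist_plus; case: ifPn => [h|_]; last by rewrite eqxx.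
apply: contraNT => h'; rewrite HN ?modes0//; lia.
Qed.

Lemma fin_minus a b n v :
  finite_set [set i | b i (dist_minus a (n - i - 1) v) != 0].
Proof.
have [N HN] := modes_trunc a v.
apply: sub_finite_set (finite_int_itv (n - 1 - N) n) => i /=.
rewrite /dist_minus; case: ifPn => [h|_]; last by rewrite modes0 eqxx.
apply: contraNT => h'; rewrite HN ?modes0//; lia.
Qed.

Let fsum_linear (F G : int -> V) (k : K) :
  finite_set [set i | F i != 0] -> finite_set [set i | G i != 0] ->
  \sum_(i \in [set: int]) (k *: F i + G i) =
  k *: (\sum_(i \in [set: int]) F i) + \sum_(i \in [set: int]) G i.
Proof.
move=> fF fG; set A := ([set i | F i != 0] `|` [set i | G i != 0])%classic.
have fA : finite_set A by rewrite finite_setU.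
have A0 i : ~ A i -> F i = 0 /\ G i = 0.
  by move=> /not_orP[/negP/negPn/eqP-> /negP/negPn/eqP->].
have w (H : int -> V) : (forall i, ~ A i -> H i = 0) ->
    \sum_(i \in [set: int]) H i = \sum_(i \in A) H i.
  by move=> H0; apply/esym/fsbig_widen => // i [_ /H0].
have wF := w F (fun i Ai => (A0 i Ai).1).
have wG := w G (fun i Ai => (A0 i Ai).2).
rewrite wF wG w; last by move=> i /A0[-> ->]; rewrite scaler0 addr0.
by rewrite !fsbig_finite//= big_split/= scaler_sumr.
Qed.

Let fsum_part (F : int -> V) i :
  (forall j, F j \in sspart V i) -> \sum_(j \in [set: int]) F j \in sspart V i.
Proof.
move=> Fi; elim/big_ind: _ => //; [exact: sspart0|exact: sspartD].
Qed.

Program Definition normal_product a b : field_on V :=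
  @FieldOn K V (normal_modes a b) (parity a (+) parity b) _ _ _.
Next Obligation.
move=> a b n k u v; rewrite /normal_modes !fctE /dist_mul.
have -> : \sum_(i \in [set: int]) dist_plus a i (b (n - i - 1) (k *: u + v)) =
   \sum_(i \in [set: int]) (k *: dist_plus a i (b (n - i - 1) u) +
      dist_plus a i (b (n - i - 1) v)).
  apply: eq_fsbigr => i _; rewrite /dist_plus; case: ifP => _.
    by rewrite !modesP.
  by rewrite scaler0 addr0.
have -> : \sum_(i \in [set: int]) b i (dist_minus a (n - i - 1) (k *: u + v)) =
   \sum_(i \in [set: int]) (k *: b i (dist_minus a (n - i - 1) u) +
      b i (dist_minus a (n - i - 1) v)).
  apply: eq_fsbigr => i _; rewrite -modesP /dist_minus; case: ifP => _.
    by rewrite !modesP.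
  by rewrite scaler0 addr0.
rewrite !fsum_linear; do ?[exact: fin_plus|exact: fin_minus].
by rewrite !scalerDr !scalerA mulrC addrACA.
Qed.
Next Obligation.
move=> a b n i v vi; rewrite /normal_modes !fctE addrC.
apply: sspartL; apply: fsum_part => j.
  rewrite addbA; apply: modes_parity; rewrite /dist_minus.
  by case: ifP => _; [exact: modes_parity|exact: sspart0].
rewrite /dist_plus; case: ifP => _; last exact: sspart0.
by rewrite [_ (+) parity b]addbC addbA; do 2!apply: modes_parity.
Qed.
Next Obligation.
move=> a b v; have [M HM] := modes_trunc a v; have [N HN] := modes_trunc b v.
have [L HL] := modes_trunc_seq b (fun k => a k%:Z v) `|M|%N.
exists (Num.max N (L + `|M|%N%:Z)) => n; rewrite ge_max => /andP[Nn Ln].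
rewrite /normal_modes !fctE /dist_mul !fsbig1 ?scaler0 ?addr0//.
- move=> i _; rewrite /dist_minus; case: ifPn => [h|_]; last exact: modes0.
  have [hM|hM] := leP M (n - i - 1); first by rewrite HM// modes0.
  have e : n - i - 1 = `|(n - i - 1)%R|%N%:Z by lia.
  by rewrite e HL//; lia.
- move=> i _; rewrite /dist_plus; case: ifPn => [h|//].
  by rewrite HN ?modes0//; lia.
Qed.

End Operations.

(* For G the series with coefficient [G j k] of lambda^j mu^k, the
   coefficients of int_0^lambda G dmu, where
   int_0^lambda lambda^j mu^k dmu = lambda^(j+k+1) / (k+1). *)
Definition formal_integral {K : numFieldType} {U : lmodType K}
    (G : nat -> nat -> U) : nat -> U :=
  fun n => \sum_(k < n) (k.+1%:R)^-1 *: G (n - k.+1)%N k.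

(* Main.v *)
Require Import Defs.
From mathcomp Require Import all_boot all_order all_algebra.
From mathcomp Require Import complex.
From mathcomp Require Import functions reals.
From mathcomp Require Import boolp classical_sets fsbigop zify.

Set Implicit Arguments.
Unset Strict Implicit.
Unset Printing Implicit Defensive.

Import Order.TTheory GRing.Theory Num.Theory.

Local Open Scope ring_scope.
Local Open Scope complex_scope.

(** Comparing coefficients of lambda^n and multiplying by n!, the claim is that
    a_(n) :bc: equals
      :(a_(n) b) c: + p(a,b) :b (a_(n) c):
        + sum_(k < n) C(n, k+1) (a_(n-k-1) b)_(k) c
    ([nproduct_normal_product]); the identity
    C(n, k+1) / n! = 1 / ((k+1) k! (n-k-1)!) turns the last sum into the formal
    integral ([bin_integral_coef]).

    Put D(z,w) = [a(z), b(w)] and E(z,w) = [a(z), c(w)]. Before any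
    multiplication by z - w, the commutator with a(z) is a superderivation of
    the normal product in w: [a(z), :bc:(w)] = :Dc: + p(a,b) :bE:
    ([comm_dist_normal]). Now multiply by (z-w)^n and take Res_z. In the second
    term nothing happens, since multiplication by w commutes with
    :b(w) _: ([iter_mul_zw_normal_distr]), and it gives :b (a_(n) c):.

    In the first term, multiplication by w does not commute with splitting D
    into its parts D_+ and D_- with respect to w: exactly one mode crosses from
    one part to the other, so that
      :(wD)c: = w :Dc: + [Res_w D, c(w)]
    ([normal_dist_shiftl]). Hence each factor z - w that is moved inside the
    normal product leaves a correction [Res_w D, c(w)], and the factors z - w
    that are still outside act on it. Writing these as
    z - w = (z - x) + (x - w), where x is the variable of which the residue is
    taken, each of them either raises the power of z - x inside the first
    bracket or that of x - w inside the second ([mul_zw_nproduct_dist]). The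
    corrections therefore obey the Pascal recursion, and the product
    (a_(n-k-1) b)_(k) c appears with coefficient C(n, k+1)
    ([iter_mul_zw_normal_distl]).

    The sums that define the normal product have finite support, depending on
    the vector; they are all compared through truncations to k < M with M
    large. *)

(** * Fields without parity *)

(** The coefficient of z^(-m-1) in (z-w)^j [a(z), b(w)] is a field in w of this
    kind for every m; all signs are carried by explicit scalars, so that one
    theory serves these fields and the homogeneous ones. *)
Definition linear_field (K : numFieldType) (V : lmodType K)
    (x : int -> V -> V) : Prop :=
  (forall n, linear (x n)) /\
  (forall v, exists N : int, forall n : int, N <= n -> x n v = 0).

(** The supercommutator [x(z), y(w)] when s is the sign p(x,y). *)
Definition comm_dist (K : numFieldType) (V : lmodType K) (s : K)
    (x y : int -> V -> V) : int -> int -> V -> V :=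
  fun m n v => x m (y n v) - s *: y n (x m v).

(** Multiplication by the variable: w x(w). *)
Definition shift_dist (V : Type) (x : int -> V -> V) : int -> V -> V :=
  fun n => x (n + 1).

(** The normal product :xy: when s is the sign p(x,y). *)
Definition normal_dist (K : numFieldType) (V : superspace K) (s : K)
    (x y : int -> V -> V) : int -> V -> V :=
  dist_mul (dist_plus x) y + s *: dist_mul y (dist_minus x).

Lemma fsum_downward (W : zmodType) (F : int -> W) (t : int) (M : nat) :
  (forall i, t <= i -> F i = 0) -> (forall i, i < t - M%:Z -> F i = 0) ->
  \sum_(i \in [set: int]) F i = \sum_(k < M) F (t - 1 - k%:Z).
Proof.
move=> hi lo; pose h (k : nat) : int := t - 1 - k%:Z.
rewrite (@fsbigE _ _ _ _ _ (map h (iota 0 M))) => //.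
- rewrite (eq_bigl xpredT); last by move=> i; rewrite in_setT.
  by rewrite big_map -(big_mkord xpredT (fun k => F (h k))) /index_iota subn0.
- by rewrite map_inj_uniq ?iota_uniq// /h => i j; lia.
- move=> i _ ni; have [/hi//|it] := lerP t i.
  have [/lo//|ti] := ltrP i (t - M%:Z).
  case/mapP: ni; exists `|(t - 1 - i)%R|%N; rewrite ?mem_iota /h; lia.
Qed.

Section LinearFields.
Context {K : numFieldType} {V : superspace K}.
Implicit Types (x y z : int -> V -> V) (D E : int -> int -> V -> V).

Lemma linear_field_modes (a : field_on V) : linear_field (a : int -> V -> V).
Proof. by split=> [n|v]; [exact: modes_linear|exact: modes_trunc]. Qed.

Lemma linear_at0 (W W' : lmodType K) (f : W -> W') :
  linear f -> f 0 = 0.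
Proof.
by move=> lf; rewrite -[X in f X](addNr 0) -[- 0]scaleN1r lf scaleN1r addNr.
Qed.

Lemma linear_atZ (W W' : lmodType K) (f : W -> W') k u :
  linear f -> f (k *: u) = k *: f u.
Proof. by move=> lf; rewrite -[k *: u]addr0 lf linear_at0// addr0. Qed.

Lemma linear_atD (W W' : lmodType K) (f : W -> W') u v :
  linear f -> f (u + v) = f u + f v.
Proof. by move=> lf; rewrite -[u]scale1r lf !scale1r. Qed.

Lemma linear_atB (W W' : lmodType K) (f : W -> W') u v :
  linear f -> f (u - v) = f u - f v.
Proof. by move=> lf; rewrite linear_atD// -scaleN1r linear_atZ// scaleN1r. Qed.

Lemma linear_at_sum (W W' : lmodType K) (f : W -> W') (M : nat)
    (F : 'I_M -> W) : linear f -> f (\sum_(k < M) F k) = \sum_(k < M) f (F k).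
Proof.
by move=> lf; apply: big_morph => [u v|]; [exact: linear_atD|exact: linear_at0].
Qed.

Lemma linear_field_comb k x y :
  linear_field x -> linear_field y -> linear_field (k *: x + y).
Proof.
move=> [lx tx] [ly ty]; split=> [n l u v|v].
  rewrite !fctE lx ly !scalerDr !scalerA mulrC; exact: addrACA.
have [N hN] := tx v; have [N' hN'] := ty v.
exists (Num.max N N') => n; rewrite ge_max => /andP[h h'].
by rewrite !fctE hN// hN'// scaler0 addr0.
Qed.

Lemma linear_field0 : linear_field (0 : int -> V -> V).
Proof. by split=> [n k u v|v]; [rewrite scaler0 addr0|exists 0]. Qed.

Lemma linear_field_shift x : linear_field x -> linear_field (shift_dist x).
Proof.
move=> [lx tx]; split=> [n|v]; first exact: lx.
have [N hN] := tx v; exists N => n Nn; apply: hN; lia.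
Qed.

Lemma linear_field_comm_dist s x y m :
  linear_field x -> linear_field y -> linear_field (comm_dist s x y m).
Proof.
move=> [lx tx] [ly ty]; split=> [n k u v|v].
  rewrite /comm_dist !(lx, ly) scalerBr scalerDr !scalerA mulrC opprD.
  exact: addrACA.
have [N hN] := ty v; have [N' hN'] := ty (x m v).
exists (Num.max N N') => n; rewrite ge_max => /andP[h h'].
by rewrite /comm_dist hN// hN'// (linear_at0 (lx m)) scaler0 subr0.
Qed.

Lemma mul_zwE D m : mul_zw D m = D (m + 1) - shift_dist (D m).
Proof. by []. Qed.

Lemma linear_field_iter_mul_zw D j :
  (forall m, linear_field (D m)) ->
  forall m, linear_field (iter j mul_zw D m).
Proof.
move=> fD; elim: j => [//|j IH] m; rewrite iterS mul_zwE -scaleN1r addrC.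
by apply: linear_field_comb; [exact: linear_field_shift|exact: IH].
Qed.

(** * Normal products as large finite sums *)

(** Truncation of y kills the terms of the first product with k large, and
    truncation of x those of the second. One bound M0 for both products, and
    all M above it, let the expansions of several normal products be taken with
    the same number of terms. *)
Lemma dist_mulE x y n v :
  linear_field x -> linear_field y ->
  exists M0 : nat, forall M, (M0 <= M)%N ->
    dist_mul (dist_plus x) y n v = \sum_(k < M) x (- 1 - k%:Z) (y (n + k%:Z) v)
    /\ dist_mul y (dist_minus x) n v = \sum_(k < M) y (n - 1 - k%:Z) (x k%:Z v).
Proof.
move=> [lx tx] [ly ty]; have [N hN] := ty v; have [N' hN'] := tx v.
exists (`|N - n|%N + `|N'|%N)%N => M hM; split.
- rewrite /dist_mul (@fsum_downward _ _ 0 M).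
  + apply: eq_bigr => k _; rewrite /dist_plus ifT; last by lia.
    by congr (x _ (y _ v)); lia.
  + by move=> i i0; rewrite /dist_plus ifF//; lia.
  + move=> i iM; rewrite hN; last by lia.
    by rewrite /dist_plus; case: ifP => _ //; exact: linear_at0.
- rewrite /dist_mul (@fsum_downward _ _ n M).
  + apply: eq_bigr => k _; rewrite /dist_minus ifT; last by lia.
    by congr (y _ (x _ v)); lia.
  + move=> i ni; rewrite /dist_minus ifF; [exact: linear_at0|lia].
  + move=> i iM; rewrite /dist_minus ifT; last by lia.
    by rewrite hN'; [exact: linear_at0|lia].
Qed.

Lemma normal_dist_at s x y n v :
  linear_field x -> linear_field y ->
  exists M0 : nat, forall M, (M0 <= M)%N ->
    normal_dist s x y n v =
    \sum_(k < M) (x (- 1 - k%:Z) (y (n + k%:Z) v)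
                  + s *: y (n - 1 - k%:Z) (x k%:Z v)).
Proof.
move=> fx fy; have [M0 H] := dist_mulE n v fx fy.
exists M0 => M /H[e1 e2].
by rewrite /normal_dist !fctE e1 e2 scaler_sumr big_split.
Qed.

Lemma normal_dist_linearl s k x x' y :
  linear_field x -> linear_field x' -> linear_field y ->
  normal_dist s (k *: x + x') y = k *: normal_dist s x y + normal_dist s x' y.
Proof.
move=> fx fx' fy; apply/funext => n; apply/funext => v.
have [M1 H1] := normal_dist_at s n v (linear_field_comb k fx fx') fy.
have [M2 H2] := normal_dist_at s n v fx fy.
have [M3 H3] := normal_dist_at s n v fx' fy.
pose M := (M1 + M2 + M3)%N.
rewrite !fctE (H1 M) ?(H2 M) ?(H3 M) /M; try lia.
rewrite scaler_sumr -big_split/=; apply: eq_bigr => i _.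
case: fy => ly _; rewrite !fctE ly !scalerDr !scalerA mulrC; exact: addrACA.
Qed.

Lemma normal_dist_linearr s k x y y' :
  linear_field x -> linear_field y -> linear_field y' ->
  normal_dist s x (k *: y + y') = k *: normal_dist s x y + normal_dist s x y'.
Proof.
move=> fx fy fy'; apply/funext => n; apply/funext => v.
have [M1 H1] := normal_dist_at s n v fx (linear_field_comb k fy fy').
have [M2 H2] := normal_dist_at s n v fx fy.
have [M3 H3] := normal_dist_at s n v fx fy'.
pose M := (M1 + M2 + M3)%N.
rewrite !fctE (H1 M) ?(H2 M) ?(H3 M) /M; try lia.
rewrite scaler_sumr -big_split/=; apply: eq_bigr => i _.
case: fx => lx _; rewrite !fctE lx !scalerDr !scalerA mulrC; exact: addrACA.
Qed.

Lemma normal_distBl s x x' y :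
  linear_field x -> linear_field x' -> linear_field y ->
  normal_dist s (x - x') y = normal_dist s x y - normal_dist s x' y.
Proof.
by move=> *; rewrite -scaleN1r addrC normal_dist_linearl// scaleN1r addrC.
Qed.

Lemma normal_distBr s x y y' :
  linear_field x -> linear_field y -> linear_field y' ->
  normal_dist s x (y - y') = normal_dist s x y - normal_dist s x y'.
Proof.
by move=> *; rewrite -scaleN1r addrC normal_dist_linearr// scaleN1r addrC.
Qed.

Lemma normal_distZl s k x y :
  linear_field x -> linear_field y ->
  normal_dist s (k *: x) y = k *: normal_dist s x y.
Proof.
move=> fx fy; have f0 := linear_field0.
rewrite -[k *: x]addr0 normal_dist_linearl//.
by rewrite -[X in _ + normal_dist s X y](subrr x) normal_distBl// subrr addr0.
Qed.

Lemma normal_distZr s k x y :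
  linear_field x -> linear_field y ->
  normal_dist s x (k *: y) = k *: normal_dist s x y.
Proof.
move=> fx fy; have f0 := linear_field0.
rewrite -[k *: y]addr0 normal_dist_linearr//.
by rewrite -[X in _ + normal_dist s x X](subrr y) normal_distBr// subrr addr0.
Qed.

(** * Normal products and multiplication by the variable *)

Lemma normal_dist_shiftr s x y :
  linear_field x -> linear_field y ->
  normal_dist s x (shift_dist y) = shift_dist (normal_dist s x y).
Proof.
move=> fx fy; apply/funext => n; apply/funext => v.
have [M1 H1] := normal_dist_at s n v fx (linear_field_shift fy).
have [M2 H2] := normal_dist_at s (n + 1) v fx fy.
pose M := (M1 + M2)%N.
rewrite /shift_dist (H1 M) ?(H2 M) /M; try lia.
apply: eq_bigr => k _; rewrite /shift_dist.
by congr (x _ (y _ v) + s *: y _ _); lia.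
Qed.

(** The mode x_(0) has index -1 in w x(w), hence enters the plus part: its
    product with y is the additional term. *)
Lemma dist_mul_plus_shift x y n v :
  linear_field x -> linear_field y ->
  dist_mul (dist_plus (shift_dist x)) y n v =
  dist_mul (dist_plus x) y (n + 1) v + x 0 (y n v).
Proof.
move=> fx fy.
have [M1 H1] := dist_mulE n v (linear_field_shift fx) fy.
have [M2 H2] := dist_mulE (n + 1) v fx fy.
pose M := (M1 + M2)%N.
(* one more term on the left, to match x_(0) *)
rewrite (H1 M.+1 _).1 ?(H2 M _).1 /M; try lia.
rewrite big_ord_recl addrC /shift_dist; congr (_ + _).
  apply: eq_bigr => k _; rewrite lift0.
  by congr (x _ (y _ v)); lia.
by congr (x _ (y _ v)); rewrite /=; lia.
Qed.

(** The mode x_(0) leaves the minus part, whence the subtracted term. *)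
Lemma dist_mul_minus_shift x y n v :
  linear_field x -> linear_field y ->
  dist_mul y (dist_minus (shift_dist x)) n v =
  dist_mul y (dist_minus x) (n + 1) v - y n (x 0 v).
Proof.
move=> fx fy.
have [M1 H1] := dist_mulE n v (linear_field_shift fx) fy.
have [M2 H2] := dist_mulE (n + 1) v fx fy.
pose M := (M1 + M2)%N.
(* one more term in the expansion that contains x_(0) *)
rewrite (H1 M _).2 ?(H2 M.+1 _).2 /M; try lia.
rewrite big_ord_recl /= addrAC.
rewrite [y _ _](_ : _ = y n (x 0 v)); last by congr (y _ (x _ v)); lia.
rewrite subrr add0r; apply: eq_bigr => k _; rewrite /bump /= add1n /shift_dist.
by congr (y _ (x _ v)); lia.
Qed.

(** The source of the integral term: :(wx)y: = w :xy: + [x_(0), y(w)]. *)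
Lemma normal_dist_shiftl s x y :
  linear_field x -> linear_field y ->
  normal_dist s (shift_dist x) y =
  shift_dist (normal_dist s x y) + comm_dist s x y 0.
Proof.
move=> fx fy; apply/funext => n; apply/funext => v.
rewrite /normal_dist !fctE dist_mul_plus_shift// dist_mul_minus_shift//.
rewrite /shift_dist /comm_dist !fctE scalerBr; exact: addrACA.
Qed.

(** * The commutator with a normal product *)

(** The bracket with x_(m) is a superderivation; s, t and r stand for the signs
    p(x,y), p(x,z) and p(y,z). Writing each term of x :yz: - s t :yz: x as a
    telescoping difference that moves x past one factor at a time, the
    intermediate terms s y x z and t r z x y cancel. In the term z y of the
    normal product x meets z first, so the sign s * r produced in y [x, z] is
    compensated by the outer s; this uses s * s = 1. *)
Lemma comm_dist_normal s t r x y z m :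
  s * s = 1 -> linear_field x -> linear_field y -> linear_field z ->
  comm_dist (s * t) x (normal_dist r y z) m =
  normal_dist (t * r) (comm_dist s x y m) z
  + s *: normal_dist (s * r) y (comm_dist t x z m).
Proof.
move=> ss fx fy fz; apply/funext => n; apply/funext => v.
have [M1 H1] := normal_dist_at r n v fy fz.
have [M2 H2] := normal_dist_at r n (x m v) fy fz.
have [M3 H3] :=
  normal_dist_at (t * r) n v (linear_field_comm_dist s m fx fy) fz.
have [M4 H4] :=
  normal_dist_at (s * r) n v fy (linear_field_comm_dist t m fx fz).
pose M := (M1 + M2 + M3 + M4)%N; case: fx fy fz => lx _ [ly _] [lz _].
rewrite !fctE {1}/comm_dist (H1 M) ?(H2 M) ?(H3 M) ?(H4 M) /M; try lia.
rewrite linear_at_sum// !scaler_sumr -sumrB -big_split/=.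
apply: eq_bigr => k _; rewrite /comm_dist.
rewrite (linear_atD _ _ (lx m)) (linear_atZ r _ (lx m)).
rewrite (linear_atB _ _ (lz _)) (linear_atB _ _ (ly _)).
rewrite (linear_atZ _ _ (lz _)) (linear_atZ _ _ (ly _)).
rewrite !(scalerDr, scalerBr, scalerA, scalerN).
rewrite (mulrA s s) ss mul1r (mulrC r t) (mulrC (t * r) s) (mulrA s t).
rewrite [RHS]addrACA subrKA [X in _ = _ + X]addrC subrKA opprD; exact: addrACA.
Qed.

(** * Multiplication by powers of z - w *)

Lemma mul_zw_linear : linear (@mul_zw K V).
Proof.
move=> k D E; apply/funext => m; apply/funext => n; apply/funext => v.
rewrite /mul_zw !fctE scalerBr opprD; exact: addrACA.
Qed.

Lemma iter_mul_zw_linear j : linear (iter j (@mul_zw K V)).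
Proof. by elim: j => [//|j IH] k D E; rewrite !iterS IH mul_zw_linear. Qed.

Lemma iter_mul_zw_shift D j m :
  iter j mul_zw (fun l => D (l + 1)) m = iter j mul_zw D (m + 1).
Proof. by elim: j m => [//|j IH] m; rewrite !iterS !mul_zwE !IH. Qed.

Lemma comm_dist_linearl s y :
  linear_field y -> linear (fun x => comm_dist s x y).
Proof.
move=> [ly _] k x x'; apply/funext => m; apply/funext => n; apply/funext => v.
rewrite /comm_dist !fctE ly scalerBr scalerDr !scalerA mulrC opprD.
exact: addrACA.
Qed.

(** The product x_(k) y when s is the sign p(x,y). *)
Definition nproduct_dist s k x y : int -> V -> V :=
  Res_z (iter k mul_zw (comm_dist s x y)).

Lemma nproduct_dist_linearl s k y :
  linear_field y -> linear (fun x => nproduct_dist s k x y).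
Proof.
move=> fy l x x'; rewrite /nproduct_dist (comm_dist_linearl s fy).
by rewrite iter_mul_zw_linear.
Qed.

(** This is z - w = (z - x) + (x - w), applied to
    Res_x (x-w)^k [D(z,x), y(w)]: the factor z - x acts on D, and the factor
    x - w raises k. *)
Lemma mul_zw_nproduct_dist s k D y :
  linear_field y ->
  mul_zw (fun m => nproduct_dist s k (D m) y) =
  (fun m => nproduct_dist s k (mul_zw D m) y)
  + (fun m => nproduct_dist s k.+1 (D m) y).
Proof.
move=> fy; apply/funext => m; rewrite addrfctE mul_zwE [in RHS]mul_zwE.
rewrite (linear_atB (f := fun x => nproduct_dist s k x y));
  last exact: nproduct_dist_linearl.
rewrite -addrA; congr (_ + _).
rewrite /nproduct_dist iterS /Res_z mul_zwE.
rewrite (iter_mul_zw_shift (comm_dist s (D m) y)).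
by rewrite addrA addNr add0r.
Qed.

(** Moving one factor z - w inside the normal product costs the correction
    Res_x [D(z,x), y(w)] of [normal_dist_shiftl]. *)
Lemma mul_zw_normal_distl s D y :
  (forall m, linear_field (D m)) -> linear_field y ->
  mul_zw (fun m => normal_dist s (D m) y) =
  (fun m => normal_dist s (mul_zw D m) y)
  + (fun m => nproduct_dist s 0 (D m) y).
Proof.
move=> fD fy; apply/funext => m; rewrite addrfctE mul_zwE [in RHS]mul_zwE.
rewrite normal_distBl//; last exact: linear_field_shift.
rewrite normal_dist_shiftl//.
rewrite -[nproduct_dist _ _ _ _]/(comm_dist s (D m) y 0).
move: (normal_dist _ _ _) (shift_dist _) (comm_dist _ _ _ _) => N S c.
by rewrite opprD addrA subrK.
Qed.

(** Induction on n: the correction created at step n is the term k = 0, and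
    the earlier corrections split in two by [mul_zw_nproduct_dist], which is
    the Pascal recursion for C(n, k+1). *)
Lemma iter_mul_zw_normal_distl s D y n :
  (forall m, linear_field (D m)) -> linear_field y ->
  iter n mul_zw (fun m => normal_dist s (D m) y) =
  (fun m => normal_dist s (iter n mul_zw D m) y)
  + \sum_(k < n) 'C(n, k.+1)%:R *:
      (fun m => nproduct_dist s k (iter (n - k.+1) mul_zw D m) y).
Proof.
move=> fD fy; elim: n => [|n IH]; first by rewrite big_ord0 addr0.
have fDn := linear_field_iter_mul_zw n fD.
rewrite iterS IH (linear_atD _ _ mul_zw_linear) (linear_at_sum _ mul_zw_linear).
rewrite mul_zw_normal_distl// -addrA.
congr (_ + _).
(* Q k j m is the coefficient of z^(-m-1) of the correction in which x - w has
   been chosen k times and z - x, or z - w before the correction arose, j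
   times. *)
pose Q k j m := nproduct_dist s k (iter j mul_zw D m) y.
transitivity (Q 0 n + \sum_(k < n) 'C(n, k.+1)%:R *:
    (Q k (n - k)%N + Q k.+1 (n - k.+1)%N)).
  congr (_ + _); apply: eq_bigr => k _.
  rewrite (linear_atZ _ _ mul_zw_linear) mul_zw_nproduct_dist// -iterS.
  by rewrite subnSK.
rewrite (eq_bigr _ (fun k _ => scalerDr _ _ _)).
rewrite big_split/= addrCA.
under [in RHS]eq_bigr do rewrite binS natrD scalerDl subSS.
rewrite big_split/=; congr (_ + _).
  by rewrite big_ord_recr/= bin_small// scale0r addr0.
by rewrite big_ord_recl/= bin0 scale1r subn0.
Qed.

Lemma iter_mul_zw_normal_distr s x E n :
  linear_field x -> (forall m, linear_field (E m)) ->
  iter n mul_zw (fun m => normal_dist s x (E m)) =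
  (fun m => normal_dist s x (iter n mul_zw E m)).
Proof.
move=> fx fE; elim: n => [//|n IH].
have fEn := linear_field_iter_mul_zw n fE.
apply/funext => m; rewrite iterS IH mul_zwE iterS [in RHS]mul_zwE.
rewrite normal_distBr//.
  by rewrite normal_dist_shiftr.
exact: linear_field_shift.
Qed.

End LinearFields.

(** * The n-th products of a normal product *)

Section Fields.
Context {K : numFieldType} {V : superspace K}.
Implicit Types a b c : field_on V.

Lemma psign_sq a b : psign a b * psign a b = 1.
Proof. by rewrite /psign -expr2 sqrr_sign. Qed.

Lemma psign_addr a b c d :
  parity d = parity b (+) parity c -> psign a d = psign a b * psign a c.
Proof. by rewrite /psign => ->; rewrite -signr_addb -andb_addr. Qed.

Lemma psignC a b : psign a b = psign b a.
Proof. by rewrite /psign andbC. Qed.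

Lemma normal_productE a b :
  normal_product a b = normal_dist (psign a b) a b :> (int -> V -> V).
Proof. by []. Qed.

Lemma nproductE j a b :
  nproduct j a b = nproduct_dist (psign a b) j a b :> (int -> V -> V).
Proof. by []. Qed.

Lemma nproduct_normal_product n a b c :
  nproduct n a (normal_product b c) =
    (normal_product (nproduct n a b) c : int -> V -> V)
    + psign a b *: (normal_product b (nproduct n a c) : int -> V -> V)
    + \sum_(k < n) 'C(n, k.+1)%:R *:
        (nproduct k (nproduct (n - k.+1) a b) c : int -> V -> V)
  :> (int -> V -> V).
Proof.
have fa := linear_field_modes a; have fb := linear_field_modes b.
have fc := linear_field_modes c.
have fD m := linear_field_comm_dist (psign a b) m fa fb.
have fE m := linear_field_comm_dist (psign a c) m fa fc.
have sD j : psign (nproduct j a b) c = psign a c * psign b c.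
  by rewrite psignC (@psign_addr c a b)// ![psign c _]psignC.
have sE : psign b (nproduct n a c) = psign a b * psign b c.
  by rewrite (@psign_addr b a c)// [psign b a]psignC.
have sN : psign a (normal_product b c) = psign a b * psign a c.
  exact: psign_addr.
pose D := comm_dist (psign a b) a b; pose E := comm_dist (psign a c) a c.
have eD : comm_dist (psign a b * psign a c) a (normal_dist (psign b c) b c) =
    psign a b *: (fun m => normal_dist (psign a b * psign b c) b (E m))
    + (fun m => normal_dist (psign a c * psign b c) (D m) c).
  apply/funext => m; rewrite comm_dist_normal// ?psign_sq//; exact: addrC.
rewrite nproductE sN /nproduct_dist eD iter_mul_zw_linear.
rewrite iter_mul_zw_normal_distr// iter_mul_zw_normal_distl//.
rewrite /Res_z !normal_productE sE sD [in RHS](addrC (normal_dist _ _ _)).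
rewrite -[RHS]addrA addrfctE scalrfctE; congr (_ + _).
rewrite addrfctE; congr (_ + _).
rewrite fct_sumE; apply: eq_bigr => k _.
by rewrite nproductE sD.
Qed.

Lemma scale_fieldE (t : K) a :
  scale_field t a = t *: (a : int -> V -> V) :> (int -> V -> V).
Proof. by []. Qed.

Lemma nproduct_scalel k (t : K) a c :
  nproduct k (scale_field t a) c =
  t *: (nproduct k a c : int -> V -> V) :> (int -> V -> V).
Proof.
have fc := linear_field_modes c.
have lin := nproduct_dist_linearl (psign a c) k fc.
exact: (linear_atZ t (a : int -> V -> V) lin).
Qed.

Lemma normal_product_scalel (t : K) a c :
  normal_product (scale_field t a) c =
  t *: (normal_product a c : int -> V -> V) :> (int -> V -> V).
Proof. exact: normal_distZl (linear_field_modes a) (linear_field_modes c). Qed.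

Lemma normal_product_scaler (t : K) a c :
  normal_product a (scale_field t c) =
  t *: (normal_product a c : int -> V -> V) :> (int -> V -> V).
Proof. exact: normal_distZr (linear_field_modes a) (linear_field_modes c). Qed.

(** The coefficient 1 / (k+1) comes from the integration of mu^k, and the two
    factorials from the two lambda-brackets. *)
Lemma bin_integral_coef n k : (k < n)%N ->
  (n`!%:R)^-1 * 'C(n, k.+1)%:R =
  (k.+1%:R)^-1 * ((k`!%:R)^-1 * ((n - k.+1)`!%:R)^-1) :> K.
Proof.
move=> kn; have fac j : j`!%:R != 0 :> K by rewrite pnatr_eq0 -lt0n fact_gt0.
rewrite -!invfM -!natrM mulnA -factS.
apply: (mulfI (fac n)); rewrite mulrA mulfV// mul1r.
by rewrite -(bin_fact kn) natrM mulfK// pnatr_eq0 -lt0n muln_gt0 !fact_gt0.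
Qed.

End Fields.

Theorem proposition3p6p3 (R : realType) (V : superspace R[i])
    (a b c : field_on V) :
  forall n : nat,
    lambda_bracket a (normal_product b c) n =
      (normal_product (lambda_bracket a b n) c : int -> V -> V)
      + psign a b *: (normal_product b (lambda_bracket a c n) : int -> V -> V)
      + formal_integral
          (fun j k => lambda_bracket (lambda_bracket a b j) c k : int -> V -> V)
          n
    :> (int -> V -> V).
Proof.
move=> n; rewrite /lambda_bracket normal_product_scalel normal_product_scaler.
rewrite scale_fieldE nproduct_normal_product scalerDr scaler_sumr.
congr (_ + _); first by rewrite scalerDr scalerA mulrC -scalerA.
apply: eq_bigr => k _; rewrite scale_fieldE nproduct_scalel !scalerA.
by rewrite bin_integral_coef// -!mulrA.
Qed.
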